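(* Let $\mathcal{H}$ be a finite dimensional real or complex inner product space, let $A:\mathcal{H}\to\mathcal{H}$ be a linear Hermitian operator, and let $\mathcal{X}$ and $\mathcal{Y}$ be subspaces of $\mathcal{H}$ with $\dim\mathcal{X}=\dim\mathcal{Y}$. Suppose that $\mathcal{X}$ is $A$-invariant and corresponds to the contiguous set of the largest eigenvalues of $A$. Let $\Theta(\mathcal{X},\mathcal{Y})<\pi/2$ and $\Lambda\left((P_{\mathcal{X}}A)|_{\mathcal{X}}\right)>\lambda_{\min(\mathcal{X}+\mathcal{Y})}$ (component-wise). Then $\Lambda\left((P_{\mathcal{Y}}A)|_{\mathcal{Y}}\right)>\lambda_{\min(\mathcal{X}+\mathcal{Y})}$ and $$0\le\log\frac{\Lambda\left((P_{\mathcal{X}}A)|_{\mathcal{X}}\right)-\lambda_{\min(\mathcal{X}+\mathcal{Y})}}{\Lambda\left((P_{\mathcal{Y}}A)|_{\mathcal{Y}}\right)-\lambda_{\min(\mathcal{X}+\mathcal{Y})}}\prec_w\log\left(1+\tan^2\Theta(\mathcal{X},\mathcal{Y})\right),$$ which leads to $$0\le\frac{\Lambda\left((P_{\mathcal{X}}A)|_{\mathcal{X}}\right)-\Lambda\left((P_{\mathcal{Y}}A)|_{\mathcal{Y}}\right)}{\Lambda\left((P_{\mathcal{Y}}A)|_{\mathcal{Y}}\right)-\lambda_{\min(\mathcal{X}+\mathcal{Y})}}\prec_w\tan^2\Theta(\mathcal{X},\mathcal{Y}).$$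
   Context: For a subspace $\mathcal{Z}$, $P_{\mathcal{Z}}$ is the orthogonal projector onto $\mathcal{Z}$, and $(P_{\mathcal{Z}}A)|_{\mathcal{Z}}$ is the restriction of $P_{\mathcal{Z}}A$ to $\mathcal{Z}$, a Hermitian operator on $\mathcal{Z}$. $\Lambda(\cdot)$ is the vector of eigenvalues of a Hermitian operator, repeated according to multiplicity and arranged in decreasing (i.e. nonincreasing) order. An $A$-invariant subspace $\mathcal{X}$ corresponds to the contiguous set of the largest eigenvalues of $A$ if the eigenvalues of $A|_{\mathcal{X}}$ are the $\dim\mathcal{X}$ largest eigenvalues of $A$, counting multiplicities. $\lambda_{\min(\mathcal{X}+\mathcal{Y})}$ is the smallest eigenvalue of $(P_{\mathcal{X}+\mathcal{Y}}A)|_{\mathcal{X}+\mathcal{Y}}$. Principal angles: for $\dim\mathcal{X}\le\dim\mathcal{Y}$, the vector $\Theta(\mathcal{X},\mathcal{Y})$ of $\dim\mathcal{X}$ angles from $\mathcal{X}$ to $\mathcal{Y}$ has components in $[0,\pi/2]$ arranged in decreasing order, and the components of $\cos^2\Theta(\mathcal{X},\mathcal{Y})$ are the eigenvalues of $(P_{\mathcal{X}}P_{\mathcal{Y}})|_{\mathcal{X}}$ arranged in increasing order. Functions (including $\log$), quotients and inequalities ($\le$, $<$) of vectors are component-wise; a scalar in a vector expression denotes the constant vector. For a real vector $x$, $x^\downarrow$ denotes its rearrangement in decreasing order. For real $n$-vectors, $x\prec_w y$ (weak majorization) means $\sum_{i=1}^k x_i^\downarrow\le\sum_{i=1}^k y_i^\downarrow$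 for $k=1,\ldots,n$. *)

(* Defs.v *)
From HB Require Import structures.
From mathcomp Require Import all_boot all_order all_algebra.
From mathcomp Require Import complex.
From mathcomp Require Import all_classical all_reals all_analysis.

Set Implicit Arguments.
Unset Strict Implicit.
Unset Printing Implicit Defensive.

Import Order.TTheory GRing.Theory Num.Theory.
Local Open Scope ring_scope.

Variant scalar_kind := RealScalars | ComplexScalars.

Definition scalars (R : realType) (k : scalar_kind) : numFieldType :=
  match k with RealScalars => R | ComplexScalars => R[i] end.

Definition conjs (R : realType) (k : scalar_kind) :
    {rmorphism scalars R k -> scalars R k} :=
  match k return {rmorphism scalars R k -> scalars R k} with
  | RealScalars => idfun
  | ComplexScalars => Num.conj
  end.

Definition ofR (R : realType) (k : scalar_kind) : R -> scalars R k :=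
  match k return R -> scalars R k with
  | RealScalars => fun x => x
  | ComplexScalars => fun x => (x%:C)%C
  end.
Arguments ofR R k x : clear implicits.

Section Spectrum.
Variables (R : realType) (k : scalar_kind) (V : vectType (scalars R k)).

(* Multiplicities are geometric; for Hermitian operators, the only ones to
   which Lambda is applied, they coincide with the algebraic ones and the real
   eigenvalues are all the eigenvalues. *)
Definition is_Lambda (f : 'End(V)) (s : seq R) :=
  sorted >=%R s /\ forall a, count_mem a s = \dim (passmx.leigenspace f (ofR R k a)).

Definition Lambda (f : 'End(V)) : seq R := xget [::] [set s | is_Lambda f s]%classic.

End Spectrum.

Section SpectrumWellDefined.
Variables (R : realType) (k : scalar_kind) (V : vectType (scalars R k)).

Lemma is_Lambda_uniq (f : 'End(V)) s t :
  is_Lambda f s -> is_Lambda f t -> s = t.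
Proof.
move=> [ss cs] [st ct].
apply: (@sorted_eq _ >=%R) => //.
- by move=> x y z yx xz; exact: le_trans xz yx.
- by move=> x y /andP[xy yx]; apply/le_anti/andP; split.
- by apply/allP => x _ /=; rewrite cs ct.
Qed.

Lemma ofR_inj : injective (ofR R k).
Proof. by case: k => //= x y []. Qed.

Lemma LambdaP (f : 'End(V)) : is_Lambda f (Lambda f).
Proof.
suff [s hs] : exists s : seq R, forall a,
    passmx.leigenspace f (ofR R k a) != 0%VS -> a \in s.
  pose d (a : R) := \dim (passmx.leigenspace f (ofR R k a)).
  apply: (@xgetPex _ [::] [set s | is_Lambda f s]%classic); exists (sort >=%R (flatten [seq nseq (d a) a | a <- undup s])).
  split=> [|a]; first by apply: sort_sorted => x y; exact: le_total.
  rewrite (permP (permEl (perm_sort _ _))) count_flatten -map_comp sumnE big_map.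
  have cE b : count_mem a (nseq (d b) b) = ((b == a) * d b)%N.
    by rewrite count_nseq.
  under eq_bigr do rewrite /= cE.
  have [as_|as_] := boolP (a \in undup s).
    rewrite (bigD1_seq a) ?undup_uniq //= eqxx mul1n big1 ?addn0 // => b.
    by move=> /negPf ->.
  rewrite big1_seq => [|b /= bs]; last first.
    by case: eqVneq bs => [->|]; rewrite ?(negPf as_).
  apply/esym/eqP; rewrite dimv_eq0; apply: contraNT as_.
  by rewrite mem_undup; exact: hs.
have e := vbasisP {:V}.
pose p := char_poly (passmx.mxof (vbasis {:V}) (vbasis {:V}) f).
have p0 : p != 0 by rewrite monic_neq0 // char_poly_monic.
have rootsP n (q : {poly scalars R k}) : (size q <= n)%N -> q != 0 ->
    exists s : seq R, forall a, root q (ofR R k a) -> a \in s.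
  elim: n q => [|n IH] q; first by rewrite leqn0 size_poly_eq0 => /eqP ->; rewrite eqxx.
  move=> sq q0; have [[a ra]|h] := pselect (exists a, root q (ofR R k a)).
    have [q' qE] := factor_theorem _ _ ra.
    have q'0 : q' != 0 by apply: contraNneq q0 => q'E; rewrite qE q'E mul0r.
    have [|s hs] := IH q' _ q'0.
      by move: sq; rewrite qE size_Mmonic ?monicXsubC // size_XsubC addn2.
    exists (a :: s) => b; rewrite qE rootM root_XsubC inE => /orP[/hs ->|].
      by rewrite orbT.
    by move=> /eqP/ofR_inj ->; rewrite eqxx.
  by exists [::] => a ra; case: h; exists a.
have [s hs] := rootsP _ _ (leqnn _) p0.
exists s => a; rewrite (passmx.leigenspaceE e) (passmx.vsof_eq0 e) => ea.
by apply: hs; rewrite -eigenvalue_root_char.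
Qed.

End SpectrumWellDefined.

Section InnerProductSpace.
Variables (R : realType) (k : scalar_kind) (V : vectType (scalars R k)).
Variable dot : {dot V for conjs R k}.

Definition hermitian_op (A : 'End(V)) := forall u v, dot (A u) v = dot u (A v).

Definition oproj (Z : {vspace V}) : 'End(V) := daddv_pi Z (orthov dot Z).

(* Meaningful when f maps Z into Z: vsproj Z inverts vsval on Z but is not the
   orthogonal projector outside of Z. *)
Definition restr_op (Z : {vspace V}) (f : 'End(V)) : 'End(subvs_of Z) :=
  linfun (vsproj Z \o f \o vsval).

Definition compress (Z : {vspace V}) (A : 'End(V)) : 'End(subvs_of Z) :=
  restr_op Z (oproj Z \o A)%VF.

(* The default 0 is only reached when Z is the zero space. *)
Definition lambda_min (Z : {vspace V}) (A : 'End(V)) : R :=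
  last 0 (Lambda (compress Z A)).

Definition corresponds_to_largest (A : 'End(V)) (X : {vspace V}) :=
  Lambda (restr_op X A) = take (\dim X) (Lambda A).

(* The eigenvalues of the restriction of P_X P_Y to X, taken in increasing
   order, are the squared cosines of the angles; an angle t in [0, pi/2] with
   cos t ^+ 2 = mu is acos (sqrt mu). *)
Definition principal_angles (X Y : {vspace V}) : seq R :=
  [seq acos (Num.sqrt mu)
  | mu <- rev (Lambda (restr_op X (oproj X \o oproj Y)%VF))].

End InnerProductSpace.

Definition weakly_majorized (R : realType) (x y : seq R) :=
  size x = size y /\
  forall j, (1 <= j <= size x)%N ->
    \sum_(i < j) (sort >=%R x)`_i <= \sum_(i < j) (sort >=%R y)`_i.

(* Main.v *)
(* Write [P] for the compression of [P_Y] to X, with eigenvalues [cos^2 Theta].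
   Since X reduces [A] inside X + Y, where [A - m >= 0], the form of [A - m] at
   [y] in Y dominates its form at [P_X y]. Parametrizing Y by [x |-> P_Y x]
   bounds the Ritz values on Y below by those of [A - m] on X squeezed by [P],
   and the logarithmic majorization becomes a multiplicative Lidskii inequality.
   The latter follows from min-max monotonicity and a determinant count after
   replacing [P] by [min(P, c) / c], with [c] the j-th smallest [cos^2].
   The second majorization is the image of the first under the increasing
   convex function [t |-> exp t - 1]. *)
Require Import Defs.
From HB Require Import structures.
From mathcomp Require Import all_boot all_order all_algebra.
From mathcomp Require Import complex.
From mathcomp Require Import all_classical all_reals all_analysis.

Set Implicit Arguments.
Unset Strict Implicit.
Unset Printing Implicit Defensive.

Import Order.TTheory GRing.Theory Num.Theory.
Local Open Scope ring_scope.

(** * Inner products over real or complex scalars *)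

(** Weak majorization tests arbitrary index sets, since the largest log quotients may stand anywhere
    in the list, whereas a determinant only controls the product over all indices. A subproduct is
    bounded by the full product as soon as every factor is at least [1], and the truncation is what
    arranges this. Write [f] and [g] for the compressions of [A - m] to X and Y, and [N] for the
    operator of squared cosines. Since [min(N, c) / c] is a contraction, the congruence [C] of [f]
    by its square root has eigenvalues at most those of [f], index by index; since it also lies
    below [N / c], those of [c C] are at most those of [g]. Each selected index then costs a factor
    [1 / c], while the ratios of [f] to [C] multiply over all indices to the product of the
    [c / min(N, c)]. For [c] the [j]-th smallest eigenvalue of [N], the two combine without loss
    into the product of the inverses of the [j] smallest eigenvalues. No exterior powers and no
    min-max principle for several indices at once are involved. *)

Section Scalars.
Variables (R : realType) (k : scalar_kind).
Notation F := (scalars R k).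
Local Notation "z ^*" := (conjs R k z) : ring_scope.

(** A left inverse of [ofR], through which the values of quadratic forms are compared in the totally
    ordered field [R], whatever the scalars. *)
Definition toR : F -> R :=
  match k return scalars R k -> R with
  | RealScalars => fun x => x
  | ComplexScalars => fun z => complex.Re z
  end.

Lemma ofR_is_zmod_morphism : zmod_morphism (ofR R k).
Proof. by rewrite /ofR; case: k => // x y; rewrite rmorphB. Qed.

Lemma ofR_is_monoid_morphism : monoid_morphism (ofR R k).
Proof. by rewrite /ofR; case: k => //; split=> [|x y]; rewrite ?rmorph1 ?rmorphM. Qed.

HB.instance Definition _ :=
  GRing.isZmodMorphism.Build R F (ofR R k) ofR_is_zmod_morphism.
HB.instance Definition _ :=
  GRing.isMonoidMorphism.Build R F (ofR R k) ofR_is_monoid_morphism.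

Lemma toR_is_zmod_morphism : zmod_morphism toR.
Proof. by rewrite /toR; case: k => // -[a b] [c d]. Qed.

HB.instance Definition _ :=
  GRing.isZmodMorphism.Build F R toR toR_is_zmod_morphism.

Lemma ofRK : cancel (ofR R k) toR.
Proof. by rewrite /toR /ofR; case: k. Qed.

Lemma toR_ofRM x z : toR (ofR R k x * z) = x * toR z.
Proof. by rewrite /toR /ofR; case: k z => // -[a b] /=; rewrite mul0r subr0. Qed.

Lemma conjs_ofR x : (ofR R k x)^* = ofR R k x.
Proof. by rewrite /conjs /ofR; case: k => //=; apply: conjc_real. Qed.

Lemma toR_gt0 z : 0 < z -> 0 < toR z.
Proof. by rewrite /toR; case: k z => //= -[a b]; rewrite ltcE => /andP[]. Qed.

Lemma toR_mulJ_ge0 z : 0 <= toR (z * z^*).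
Proof.
rewrite /toR /conjs; case: k z => [z|[a b]] /=; first exact: sqr_ge0.
by rewrite mulrN opprK addr_ge0 // -expr2 sqr_ge0.
Qed.

Lemma ofR_toR_gt0 z : 0 < z -> ofR R k (toR z) = z.
Proof.
by rewrite /toR /ofR; case: k z => //= -[a b]; rewrite ltcE => /andP[/= /eqP ->].
Qed.

End Scalars.

Section InnerProducts.
Variables (R : realType) (k : scalar_kind).
Notation F := (scalars R k).
Local Notation "z ^*" := (conjs R k z) : ring_scope.

(* A predicate rather than the structure [{dot V for _}], so that it transfers
   to subspaces by mere restriction. *)
Record inner_product (V : vectType F) (d : V -> V -> F) : Prop := InnerProduct {
  ip_linear : forall a u v w, d (a *: u + v) w = a * d u w + d v w;
  ip_conj : forall u v, d u v = (d v u)^*;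
  ip_gt0 : forall u, u != 0 -> 0 < d u u }.

Section Basics.
Variables (V : vectType F) (d : V -> V -> F).
Hypothesis ipd : inner_product d.

(** Valued in [F^o] so as to be a linear map of vector spaces, whose kernel is the orthogonal
    complement of [w]. *)
Definition ip_left (w : V) (u : V) : F^o := d u w.
Lemma ip_left_linear w : linear (ip_left w).
Proof. by move=> a u v; exact: ip_linear. Qed.
HB.instance Definition _ w :=
  GRing.isLinear.Build F V F^o *:%R (ip_left w) (ip_left_linear w).

Lemma ip0l w : d 0 w = 0. Proof. exact: (linear0 (ip_left w)). Qed.
Lemma ipDl u v w : d (u + v) w = d u w + d v w.
Proof. exact: (linearD (ip_left w)). Qed.
Lemma ipBl u v w : d (u - v) w = d u w - d v w.
Proof. exact: (linearB (ip_left w)). Qed.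
Lemma ipZl a u w : d (a *: u) w = a * d u w.
Proof. exact: (linearZ_LR (ip_left w)). Qed.
Lemma ip_suml I (r : seq I) (P : pred I) (h : I -> V) w :
  d (\sum_(i <- r | P i) h i) w = \sum_(i <- r | P i) d (h i) w.
Proof. exact: (linear_sum (ip_left w)). Qed.

Lemma ipDr u v w : d w (u + v) = d w u + d w v.
Proof. by rewrite !(ip_conj ipd w) ipDl rmorphD. Qed.
Lemma ipBr u v w : d w (u - v) = d w u - d w v.
Proof. by rewrite !(ip_conj ipd w) ipBl rmorphB. Qed.
Lemma ipZr a u w : d w (a *: u) = a^* * d w u.
Proof. by rewrite !(ip_conj ipd w) ipZl rmorphM. Qed.
Lemma ip_sumr I (r : seq I) (P : pred I) (h : I -> V) w :
  d w (\sum_(i <- r | P i) h i) = \sum_(i <- r | P i) d w (h i).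
Proof.
rewrite (ip_conj ipd) ip_suml rmorph_sum; apply: eq_bigr => i _.
by rewrite -ip_conj.
Qed.

Definition self_adjoint (f : 'End(V)) := forall u v, d (f u) v = d u (f v).

Definition qform (f : 'End(V)) v : R := toR (d (f v) v).
Definition sqnorm v : R := toR (d v v).

Lemma sqnorm_gt0 v : v != 0 -> 0 < sqnorm v.
Proof. by move=> v0; apply: toR_gt0; exact: ip_gt0. Qed.
Lemma sqnorm_ge0 v : 0 <= sqnorm v.
Proof. by have [->|/sqnorm_gt0/ltW//] := eqVneq v 0; rewrite /sqnorm ip0l raddf0. Qed.

Lemma ofR_sqnorm v : d v v = ofR R k (sqnorm v).
Proof.
have [->|/(ip_gt0 ipd) v0] := eqVneq v 0; last by rewrite ofR_toR_gt0.
by rewrite /sqnorm ip0l !raddf0.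
Qed.

Lemma qform_eigen (f : 'End(V)) v a :
  f v = ofR R k a *: v -> qform f v = a * sqnorm v.
Proof. by move=> fv; rewrite /qform fv ipZl toR_ofRM. Qed.

End Basics.

Definition sub_ip (V : vectType F) (d : V -> V -> F) (W : {vspace V}) :=
  fun u v : subvs_of W => d (vsval u) (vsval v).

Lemma inner_product_sub (V : vectType F) (d : V -> V -> F) (W : {vspace V}) :
  inner_product d -> inner_product (@sub_ip V d W).
Proof.
rewrite /sub_ip => ipd; split=> [a u v w|u v|u u0].
- by rewrite linearP; exact: ip_linear.
- exact: ip_conj.
- by apply: ip_gt0 => //; apply: contraNneq u0 => u0; apply/eqP/val_inj.
Qed.

(* The invariant plane of an eigenvector [u + iv] of the complexification, for
   the eigenvalue [a + ib]; over the complex scalars one takes [v = - iu]. *)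
Lemma complexified_eigenvector n (M : 'M[F]_n) : (0 < n)%N ->
  exists (a b : R) (u v : 'rV[F]_n),
    [/\ (u != 0) || (v != 0),
        u *m M = ofR R k a *: u - ofR R k b *: v
      & v *m M = ofR R k b *: u + ofR R k a *: v].
Proof.
have closed (N : 'M[R[i]]_n) : (0 < n)%N ->
    exists z, exists2 c : 'rV_n, c *m N = z *: c & c != 0.
  move=> n0; have /closed_rootP[z] : size (char_poly N) != 1%N.
    by rewrite size_char_poly eqSS -lt0n.
  by rewrite -eigenvalue_root_char => /eigenvalueP[c cN c0]; exists z, c.
rewrite /scalars /ofR in M *; case: k M => M n0.
  have [[a b] [c cN c0]] := closed (map_mx (real_complex R) M) n0.
  have cNE j : (c *m map_mx (real_complex R) M) 0 j
     = ((map_mx (@complex.Re R) c *m M) 0 j +i*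
        (map_mx (@complex.Im R) c *m M) 0 j)%C.
    rewrite !mxE; elim/big_rec3: _ => // i x y _ _ ->.
    by rewrite !mxE; case: (c 0 i) => p q /=; simpc.
  exists a, b, (map_mx (@complex.Re R) c), (map_mx (@complex.Im R) c); split.
  - apply: contraNT c0; rewrite negb_or !negbK => /andP[/eqP rc /eqP ic].
    apply/eqP/rowP => j; move/rowP/(_ j): rc; move/rowP/(_ j): ic.
    by rewrite !mxE; case: (c 0 j) => p q /= -> ->.
  - apply/rowP => j; have := cNE j; rewrite cN !mxE.
    by case: (c 0 j) => p q /= [<- _].
  - apply/rowP => j; have := cNE j; rewrite cN !mxE.
    by case: (c 0 j) => p q /= [_ <-]; rewrite addrC.
have [[a b] [c cN c0]] := closed M n0.
exists a, b, c, (- 'i%C *: c); split; first by rewrite c0.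
  rewrite cN scalerA -scalerBl; congr (_ *: _).
  by simpc.
rewrite -scalemxAl cN !scalerA -scalerDl; congr (_ *: _).
by simpc.
Qed.

(** On the plane of [u] and [v] with eigenvalue [a + ib], the equality of [d (f u) v] and
    [d u (f v)] reduces to [b (|u|^2 + |v|^2) = 0]. Hence [b = 0], and whichever of [u], [v] is
    nonzero is an eigenvector for the real value [a]. *)
Lemma self_adjoint_eigen_exists (V : vectType F) (d : V -> V -> F) (f : 'End(V)) :
  inner_product d -> self_adjoint d f -> (0 < \dim {:V})%N ->
  exists a v, v != 0 /\ f v = ofR R k a *: v.
Proof.
move=> ipd fsa V0; have Vb := vbasisP {:V}.
pose vec := passmx.vecof (vbasis {:V}).
pose M := passmx.mxof (vbasis {:V}) (vbasis {:V}) f.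
have fvec c : f (vec c) = vec (c *m M) by exact: passmx.hom_vecof.
have vec0 c : (vec c == 0) = (c == 0) by exact: passmx.vecof_eq0.
have vecL x y c1 c2 : vec (x *: c1 + y *: c2) = x *: vec c1 + y *: vec c2.
  have vecP : linear vec by exact: passmx.vecof_linear.
  by rewrite vecP -[y *: c2]addr0 vecP (eqP (etrans (vec0 0) (eqxx 0))) addr0.
have [a [b [u [v [uv0 uM vM]]]]] := complexified_eigenvector M V0.
have fu : f (vec u) = ofR R k a *: vec u - ofR R k b *: vec v.
  by rewrite fvec uM -!scaleNr vecL.
have fv : f (vec v) = ofR R k b *: vec u + ofR R k a *: vec v.
  by rewrite fvec vM vecL.
have b0 : b = 0.
  have := fsa (vec u) (vec v).
  rewrite fu fv (ipBl ipd) (ipDr ipd) !(ipZl ipd) !(ipZr ipd) !conjs_ofR.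
  rewrite (ofR_sqnorm ipd (vec u)) (ofR_sqnorm ipd (vec v)) addrC => /addIr /eqP.
  rewrite eq_sym -subr_eq0 opprK -!rmorphM -rmorphD -mulrDr => /eqP.
  move/(congr1 (@toR R k)); rewrite ofRK raddf0 => /eqP.
  rewrite mulf_eq0 => /orP[/eqP //|]; rewrite gt_eqF //.
  case/orP: uv0 => [u0|v0].
    by rewrite ltr_pwDl ?(sqnorm_ge0 ipd) ?(sqnorm_gt0 ipd) ?vec0.
  by rewrite ltr_wpDl ?(sqnorm_ge0 ipd) ?(sqnorm_gt0 ipd) ?vec0.
case/orP: uv0 => w0; [exists a, (vec u) | exists a, (vec v)].
  by rewrite vec0 fu b0 rmorph0 scale0r subr0.
by rewrite vec0 fv b0 rmorph0 scale0r add0r.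
Qed.

End InnerProducts.

(** * Spectral theorem *)

Section Spectral.
Variables (R : realType) (k : scalar_kind).
Notation F := (scalars R k).
Local Notation "z ^*" := (conjs R k z) : ring_scope.

Lemma dim_subvs (V : vectType F) (W : {vspace V}) : \dim {:subvs_of W} = \dim W.
Proof. by rewrite dimvf. Qed.

Lemma restr_opE (V : vectType F) (W : {vspace V}) (f : 'End(V)) u :
  f (vsval u) \in W -> vsval (restr_op W f u) = f (vsval u).
Proof. by move=> fu; rewrite lfunE /= vsprojK. Qed.

(** Families are indexed by [nat] and constrained only below [n], so that prepending a vector or
    permuting the family involves no ordinal casts. *)
Definition orthonormal_upto (V : vectType F) (d : V -> V -> F) n (e : nat -> V) :=
  forall i j, (i < n)%N -> (j < n)%N -> d (e i) (e j) = (i == j)%:R.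

Section Expansion.
Variables (V : vectType F) (d : V -> V -> F).
Hypothesis ipd : inner_product d.

Lemma orthonormal_coord n e (c : nat -> F) j : orthonormal_upto d n e -> (j < n)%N ->
  d (\sum_(i < n) c i *: e i) (e j) = c j.
Proof.
move=> oe jn; rewrite (ip_suml ipd) (bigD1 (Ordinal jn)) //= (ipZl ipd) oe // eqxx.
rewrite mulr1 big1 ?addr0 // => i /eqP ij.
rewrite (ipZl ipd) oe //; case: eqP => [ij'|]; last by rewrite mulr0.
by case: ij; exact: val_inj.
Qed.

Lemma orthonormal_free n e : orthonormal_upto d n e -> free (mkseq e n).
Proof.
move=> oe; have -> : mkseq e n = [tuple e i | i < n].
  by rewrite /mkseq -val_enum_ord -map_comp.
apply/freeP => c c0 j.
have := @orthonormal_coord n e (fun i => oapp c 0 (insub i)) j oe (ltn_ord j).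
rewrite /= valK /= => <-.
rewrite [X in d X _](_ : _ = 0) ?(ip0l ipd) // -[RHS]c0.
by apply: eq_bigr => i _; rewrite valK nth_mktuple.
Qed.

Lemma orthonormal_free_map n e s : orthonormal_upto d n e ->
  uniq s -> (forall i, i \in s -> (i < n)%N) -> free [seq e i | i <- s].
Proof.
move=> oe us sn; rewrite -{1}[s](mkseq_nth 0%N) -map_comp.
apply: orthonormal_free => i j si sj /=.
by rewrite oe ?sn ?mem_nth // nth_uniq.
Qed.

Lemma orthonormal_expand n e v : orthonormal_upto d n e -> n = \dim {:V} ->
  v = \sum_(i < n) d v (e i) *: e i.
Proof.
move=> oe nE.
have eb : basis_of {:V} [tuple e i | i < n].
  rewrite basisEfree subvf size_tuple -nE leqnn andbT andbT.
  have -> : tval [tuple e i | i < n] = mkseq e n.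
    by rewrite /mkseq -val_enum_ord -map_comp.
  exact: orthonormal_free.
have cE : v = \sum_(i < n) coord [tuple e i | i < n] i v *: e i.
  apply: etrans (coord_basis eb (memvf v)) _; apply: eq_bigr => i _.
  by rewrite nth_mktuple.
rewrite {1}cE; apply: eq_bigr => j _; congr (_ *: _).
pose c i := oapp (fun i => coord [tuple e i | i < n] i v) 0 (insub i).
have := @orthonormal_coord n e c j oe (ltn_ord j).
rewrite /c /= valK /= => <-; rewrite [in RHS]cE; congr (d _ _).
by apply: eq_bigr => i _; rewrite valK.
Qed.

Lemma orthonormal_parseval n e u v : orthonormal_upto d n e -> n = \dim {:V} ->
  d u v = \sum_(i < n) d u (e i) * (d v (e i))^*.
Proof.
move=> oe nE; rewrite {1}(orthonormal_expand u oe nE) (ip_suml ipd).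
by apply: eq_bigr => i _; rewrite (ipZl ipd) -(ip_conj ipd).
Qed.

End Expansion.

(** Induction on the dimension: a self-adjoint operator preserves the orthogonal complement of an
    eigenvector, and the restricted product makes that complement a space of the same kind. *)
Lemma orthonormal_eigenbasis_unsorted n (V : vectType F) d (f : 'End(V)) :
  inner_product d -> self_adjoint d f -> n = \dim {:V} ->
  exists e l, orthonormal_upto d n e /\
    forall i, (i < n)%N -> f (e i) = ofR R k (l i) *: e i.
Proof.
elim: n V d f => [|n IH] V d f ipd fsa nE.
  by exists (fun=> 0), (fun=> 0); split => // i.
have [|a [v [v0 fv]]] := self_adjoint_eigen_exists ipd fsa; first by rewrite -nE.
have nv0 := sqnorm_gt0 ipd v0.
pose e0 := ofR R k (Num.sqrt (sqnorm d v))^-1 *: v.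
have e01 : d e0 e0 = 1.
  rewrite (ipZl ipd) (ipZr ipd) conjs_ofR (ofR_sqnorm ipd) -!rmorphM mulrA.
  by rewrite -invfM -expr2 sqr_sqrtr ?ltW // mulVf ?rmorph1 ?gt_eqF.
have fe0 : f e0 = ofR R k a *: e0 by rewrite linearZ /= fv !scalerA mulrC.
(* The orthogonal complement of [e0]. The linear form is nonzero at [e0], so its image is a line and
   the rank formula leaves dimension [n]. *)
pose W := lker (linfun (ip_left d e0 : V -> F^o)).
have memW u : (u \in W) = (d u e0 == 0) by rewrite memv_ker lfunE.
have dimW : n = \dim W.
  have := limg_ker_dim (linfun (ip_left d e0 : V -> F^o)) {:V}.
  rewrite capfv -/W -nE; suff -> : \dim (limg (linfun (ip_left d e0 : V -> F^o))) = 1%N.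
    by rewrite addn1 => -[].
  apply/eqP; rewrite eqn_leq; apply/andP; split.
    by rewrite (leq_trans (dimvS (subvf _))) // dimvf.
  rewrite lt0n dimv_eq0; apply/eqP => im0.
  have := memv_img (linfun (ip_left d e0 : V -> F^o)) (memvf e0).
  rewrite im0 memv0 lfunE.
  by move/eqP; rewrite -[LHS]/(d e0 e0) e01; apply/eqP; rewrite oner_eq0.
have fW u : u \in W -> f u \in W.
  by rewrite !memW fsa fe0 (ipZr ipd _ e0) => /eqP ->; rewrite mulr0.
have restrE u : vsval (restr_op W f u) = f (vsval u).
  by rewrite restr_opE ?fW ?subvsP.
have [||e [l [oe fe]]] := IH _ _ (restr_op W f) (inner_product_sub W ipd).
- by move=> u v'; rewrite /sub_ip !restrE fsa.
- by rewrite dim_subvs.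
exists (fun i => if i is i'.+1 then vsval (e i') else e0).
exists (fun i => if i is i'.+1 then l i' else a).
have eW i : d (vsval (e i)) e0 = 0 by apply/eqP; rewrite -memW subvsP.
split=> [[|i] [|j] //= i1 j1|[|i] i1 //].
- by rewrite (ip_conj ipd) eW rmorph0.
- by rewrite -[LHS]/(sub_ip d (e i) (e j)) oe // eqSS.
- by rewrite -restrE fe // linearZ.
Qed.

(** By self-adjointness an eigenvector for [a] is orthogonal to every [e i] with [l i] different
    from [a]; the eigenspace is therefore spanned by the remaining [e i]. *)
Lemma orthonormal_eigenspace n (V : vectType F) d (f : 'End(V)) e l a :
  inner_product d -> self_adjoint d f -> n = \dim {:V} -> orthonormal_upto d n e ->
  (forall i, (i < n)%N -> f (e i) = ofR R k (l i) *: e i) ->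
  \dim (passmx.leigenspace f (ofR R k a)) = count_mem a (mkseq l n).
Proof.
move=> ipd fsa nE oe fe.
pose s := [seq i <- iota 0 n | l i == a].
have us : uniq s by rewrite filter_uniq ?iota_uniq.
have sP i : (i \in s) = (l i == a) && (i < n)%N.
  by rewrite mem_filter mem_iota add0n.
have fs : free [seq e i | i <- s].
  by apply: orthonormal_free_map oe us _ => // i; rewrite sP => /andP[].
have -> : count_mem a (mkseq l n) = size [seq e i | i <- s].
  by rewrite size_map /mkseq count_map size_filter.
move: fs => /eqnP <-; congr (\dim _); apply/eqP; rewrite eqEsubv; apply/andP; split.
  apply/subvP => u; rewrite memv_ker add_lfunE opp_lfunE scale_lfunE.
  rewrite id_lfunE subr_eq0 => /eqP fu.
  rewrite [u](orthonormal_expand ipd u oe nE); apply: memv_suml => i _.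
  have [la|la] := eqVneq (l i) a.
    by apply/memvZ/memv_span/map_f; rewrite sP la eqxx /=.
  suff -> : d u (e i) = 0 by rewrite scale0r mem0v.
  have := fsa u (e i); rewrite fu fe // (ipZl ipd) (ipZr ipd) conjs_ofR => /eqP.
  rewrite -subr_eq0 -mulrBl mulf_eq0 subr_eq0 (inj_eq (@ofR_inj R k)) eq_sym.
  by rewrite (negPf la) => /eqP.
apply/span_subvP => w /mapP[j]; rewrite sP => /andP[/eqP <- j1] ->.
by rewrite memv_ker add_lfunE opp_lfunE scale_lfunE id_lfunE fe // subrr.
Qed.

(** By the count of multiplicities, the sorted diagonal satisfies [is_Lambda], whose uniqueness
    identifies it with [Lambda f]. The sorting permutation then reorders the eigenbasis. *)
Lemma spectral_theorem (V : vectType F) d (f : 'End(V)) :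
  inner_product d -> self_adjoint d f ->
  size (Lambda f) = \dim {:V} /\
  exists e, orthonormal_upto d (\dim {:V}) e /\
    forall i, (i < \dim {:V})%N -> f (e i) = ofR R k (Lambda f)`_i *: e i.
Proof.
move=> ipd fsa; set n := \dim {:V}.
have [e [l [oe fe]]] := orthonormal_eigenbasis_unsorted ipd fsa (erefl n).
have LE : Lambda f = sort >=%R (mkseq l n).
  apply: is_Lambda_uniq (LambdaP f) _; split=> [|a].
    by apply: sort_sorted => x y; exact: le_total.
  rewrite (permP (permEl (perm_sort _ _))).
  by rewrite (orthonormal_eigenspace a ipd fsa (erefl n) oe fe).
split; first by rewrite LE size_sort size_mkseq.
have : perm_eq (Lambda f) (mkseq l n) by rewrite LE perm_sort.
case/(perm_iotaP 0); rewrite size_mkseq => s sn {}LE.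
have s_size : size s = n by rewrite (perm_size sn) size_iota.
have s_lt i : (i < n)%N -> (nth 0%N s i < n)%N.
  by rewrite -{1}s_size => /(mem_nth 0%N); rewrite (perm_mem sn) mem_iota.
exists (e \o nth 0%N s); split=> [i j i1 j1|i i1] /=.
  by rewrite oe ?s_lt // nth_uniq ?s_size // (perm_uniq sn) iota_uniq.
by rewrite LE (nth_map 0%N) ?s_size // nth_mkseq ?s_lt // fe ?s_lt.
Qed.

End Spectral.

(** * Min-max monotonicity and determinants *)

Section MinMax.
Variables (R : realType) (k : scalar_kind).
Notation F := (scalars R k).
Local Notation "z ^*" := (conjs R k z) : ring_scope.

Lemma ge_transitive : transitive (>=%R : rel R).
Proof. by move=> y x z yx zy; exact: le_trans zy yx. Qed.

Lemma Lambda_nth_le (V : vectType F) (f : 'End(V)) i j :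
  (i <= j)%N -> (j < size (Lambda f))%N -> (Lambda f)`_j <= (Lambda f)`_i.
Proof.
move=> ij js; have [s_sorted _] := LambdaP f.
apply: (sorted_leq_nth ge_transitive _ 0 s_sorted) => //.
  by move=> x; exact: lexx.
by rewrite inE; exact: leq_ltn_trans js.
Qed.

Section EigenSums.
Variables (V : vectType F) (d : V -> V -> F) (f : 'End(V)) (e : nat -> V).
Hypotheses (ipd : inner_product d) (oe : orthonormal_upto d (\dim {:V}) e).

Definition coord_sq v i : R := toR (d v (e i) * (d v (e i))^*).

Lemma coord_sq_ge0 v i : 0 <= coord_sq v i.
Proof. exact: toR_mulJ_ge0. Qed.

Lemma sqnorm_sum v : sqnorm d v = \sum_(i < \dim {:V}) coord_sq v i.
Proof. by rewrite /sqnorm {1}(orthonormal_parseval ipd v v oe) // raddf_sum. Qed.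

Hypothesis fe :
  forall i, (i < \dim {:V})%N -> f (e i) = ofR R k (Lambda f)`_i *: e i.
Hypothesis fsa : self_adjoint d f.

Lemma ip_eigenvector v i : (i < \dim {:V})%N ->
  d (f v) (e i) = ofR R k (Lambda f)`_i * d v (e i).
Proof. by move=> i1; rewrite fsa fe // (ipZr ipd) conjs_ofR. Qed.

Lemma qform_sum v :
  qform d f v = \sum_(i < \dim {:V}) (Lambda f)`_i * coord_sq v i.
Proof.
rewrite /qform (orthonormal_parseval ipd _ v oe) // raddf_sum.
by apply: eq_bigr => i _; rewrite ip_eigenvector // -mulrA; exact: toR_ofRM.
Qed.

End EigenSums.

(* Courant-Fischer: [phi] maps the span of the top [i + 1] eigenvectors of [f]
   onto a space meeting the span of the eigenvectors of [g] from index [i] on. *)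
Lemma le_Lambda (V V' : vectType F) d d' (f : 'End(V)) (g : 'End(V'))
    (phi : 'Hom(V, V')) i (t : R) :
  inner_product d -> inner_product d' ->
  self_adjoint d f -> self_adjoint d' g -> (i < \dim {:V})%N ->
  (forall v, v != 0 -> phi v != 0) ->
  (forall v, (Lambda f)`_i * sqnorm d v <= qform d f v ->
     t * sqnorm d' (phi v) <= qform d' g (phi v)) ->
  t <= (Lambda g)`_i.
Proof.
move=> ipd ipd' fsa gsa i1 phi0 fg.
have [sf [e [oe fe]]] := spectral_theorem ipd fsa.
have [sg [e' [oe' ge']]] := spectral_theorem ipd' gsa.
pose G := \matrix_(a < i.+1, b < i) d' (phi (e a)) (e' b).
(* [G] has [i + 1] rows and [i] columns, so some nonzero combination of the top eigenvectors of [f]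
   has an image orthogonal to the first [i] eigenvectors of [g]. *)
have /rowV0Pn[c /sub_kermxP cG c0] : kermx G != 0.
  by rewrite -mxrank_eq0 mxrank_ker subn_eq0 -ltnNge ltnS rank_leq_col.
pose c' a := oapp (c 0) 0 (insub a : option 'I_i.+1).
pose v := \sum_(a < \dim {:V}) c' a *: e a.
have dv j : (j < \dim {:V})%N -> d v (e j) = c' j.
  exact: (orthonormal_coord ipd c' oe).
have c'0 j : (i < j)%N -> c' j = 0 by move=> ij; rewrite /c' insubF // ltnNge ij.
have v0 : v != 0.
  apply: contraNneq c0 => v0; apply/eqP/rowP => a; rewrite mxE.
  have := dv a (leq_trans (ltn_ord a) i1).
  by rewrite v0 (ip0l ipd) /c' valK /= => <-.
have fv : (Lambda f)`_i * sqnorm d v <= qform d f v.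
  rewrite (sqnorm_sum ipd oe) (qform_sum ipd oe fe fsa) mulr_sumr.
  apply: ler_sum => j _; have [ij|ji] := ltnP i j.
    by rewrite /coord_sq dv // c'0 // mul0r !raddf0 !mulr0.
  by rewrite ler_wpM2r ?coord_sq_ge0 // Lambda_nth_le // sf.
have dw b : (b < i)%N -> d' (phi v) (e' b) = 0.
  move=> bi; have /rowP/(_ (Ordinal bi)) := cG; rewrite !mxE => <-.
  rewrite linear_sum (ip_suml ipd').
  pose h a := d' (phi (c' a *: e a)) (e' b).
  transitivity (\sum_(a < i.+1) h a); last first.
    by apply: eq_bigr => a _; rewrite /h linearZ (ipZl ipd') mxE /c' valK.
  rewrite (big_ord_widen _ h i1) [RHS]big_mkcond; apply: eq_bigr => a _.
  by case: ltnP => // ia; rewrite c'0 // scale0r linear0 (ip0l ipd').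
have := fg v fv; have := sqnorm_gt0 ipd' (phi0 _ v0) => w0.
suff gw : qform d' g (phi v) <= (Lambda g)`_i * sqnorm d' (phi v).
  by move=> /le_trans/(_ gw); rewrite ler_pM2r.
rewrite (sqnorm_sum ipd' oe') (qform_sum ipd' oe' ge' gsa) mulr_sumr.
apply: ler_sum => b _; have [bi|ib] := ltnP b i.
  by rewrite /coord_sq dw // mul0r !raddf0 !mulr0.
by rewrite ler_wpM2r ?coord_sq_ge0 // Lambda_nth_le // sg.
Qed.

End MinMax.

Section Determinants.
Variables (R : realType) (k : scalar_kind).
Notation F := (scalars R k).
Local Notation "z ^*" := (conjs R k z) : ring_scope.
Variables (V : vectType F) (d : V -> V -> F).
Hypothesis ipd : inner_product d.
Notation n := (\dim {:V}).

(** Row [i] holds the coordinates of [f (e i)]: matrices act on row vectors, hence composition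
    reverses products. *)
Definition op_mx (e : nat -> V) (f : 'End(V)) : 'M[F]_n :=
  \matrix_(i, j) d (f (e i)) (e j).

Lemma op_mx_comp e f g : orthonormal_upto d n e ->
  op_mx e (f \o g)%VF = op_mx e g *m op_mx e f.
Proof.
move=> oe; apply/matrixP => i j; rewrite !mxE comp_lfunE.
rewrite {1}(orthonormal_expand ipd (g (e i)) oe) // linear_sum (ip_suml ipd).
by apply: eq_bigr => l _; rewrite linearZ (ipZl ipd) !mxE.
Qed.

Lemma det_op_mx_basis e e' f : orthonormal_upto d n e -> orthonormal_upto d n e' ->
  \det (op_mx e f) = \det (op_mx e' f).
Proof.
move=> oe oe'; pose Q := \matrix_(i < n, j < n) d (e' i) (e j).
pose Q' := \matrix_(i < n, j < n) d (e i) (e' j).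
have QQ' : Q *m Q' = 1%:M.
  apply/matrixP => i j; rewrite !mxE -(oe' i j) //.
  rewrite [in RHS](orthonormal_expand ipd (e' i) oe) // (ip_suml ipd).
  by apply: eq_bigr => l _; rewrite (ipZl ipd) !mxE.
have fQ : op_mx e' f *m Q = Q *m op_mx e f.
  apply/matrixP => i j; rewrite !mxE; transitivity (d (f (e' i)) (e j)).
    rewrite [in RHS](orthonormal_expand ipd (f (e' i)) oe') // (ip_suml ipd).
    by apply: eq_bigr => l _; rewrite (ipZl ipd) !mxE.
  rewrite [X in d (f X) _](orthonormal_expand ipd (e' i) oe) // linear_sum (ip_suml ipd).
  by apply: eq_bigr => l _; rewrite linearZ (ipZl ipd) !mxE.
have Q0 : \det Q != 0.
  by apply/eqP => Q0; have := oner_neq0 F; rewrite -(det1 F n) -QQ' det_mulmx Q0 mul0r eqxx.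
by apply: (mulfI Q0); rewrite -det_mulmx -fQ det_mulmx mulrC.
Qed.

Lemma det_op_mx_diag e (f : 'End(V)) r : orthonormal_upto d n e ->
  (forall i, (i < n)%N -> f (e i) = ofR R k (r i) *: e i) ->
  \det (op_mx e f) = ofR R k (\prod_(i < n) r i).
Proof.
move=> oe fe; have -> : op_mx e f = diag_mx (\row_i ofR R k (r i)).
  apply/matrixP => i j; rewrite !mxE fe // (ipZl ipd) oe // mulr_natr.
  by rewrite (inj_eq val_inj).
by rewrite det_diag rmorph_prod; apply: eq_bigr => i _; rewrite mxE.
Qed.

(** The basis [e] need not diagonalize [f], so operators with different eigenbases can be multiplied
    and their eigenvalue products compared. *)
Lemma prod_Lambda e f : self_adjoint d f -> orthonormal_upto d n e ->
  ofR R k (\prod_(i < n) (Lambda f)`_i) = \det (op_mx e f).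
Proof.
move=> fsa oe; have [_ [e' [oe' fe']]] := spectral_theorem ipd fsa.
by rewrite (det_op_mx_basis _ oe oe') (det_op_mx_diag oe' fe').
Qed.

(** Serves as a functional calculus: with [e] an eigenbasis of [N], it yields square roots and
    quotients of functions of [N]. *)
Lemma diagonal_operator_exists e (r : nat -> R) : orthonormal_upto d n e ->
  exists s : 'End(V), self_adjoint d s /\
    forall i, (i < n)%N -> s (e i) = ofR R k (r i) *: e i.
Proof.
move=> oe; pose h v := \sum_(i < n) (ofR R k (r i) * d v (e i)) *: e i.
have h_lin : linear h.
  move=> a u v; rewrite scaler_sumr -big_split; apply: eq_bigr => i _ /=.
  by rewrite scalerA -scalerDl (ip_linear ipd) mulrDr mulrCA.
pose H : {linear V -> V} := HB.pack h (GRing.isLinear.Build F V V *:%R h h_lin).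
have hE v : linfun H v = h v by rewrite lfunE.
exists (linfun H); split=> [u v|i i1]; rewrite !hE.
  rewrite (ip_suml ipd) (ip_sumr ipd); apply: eq_bigr => i _.
  rewrite (ipZl ipd) (ipZr ipd) rmorphM conjs_ofR (ip_conj ipd (e i) v) -mulrA.
  by rewrite -!mulrA; congr (_ * _); rewrite (ip_conj ipd u) mulrC.
rewrite /h (bigD1 (Ordinal i1)) //= oe // eqxx mulr1 big1 ?addr0 // => j /eqP ji.
rewrite oe //; case: eqP => [ij|]; last by rewrite mulr0 scale0r.
by case: ji; exact: val_inj.
Qed.

End Determinants.

(** * Multiplicative Lidskii inequality *)

Section Lidskii.
Variables (R : realType) (k : scalar_kind).
Notation F := (scalars R k).

Lemma ler_prod_uniq_sub n (s : seq nat) (a : nat -> R) :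
  uniq s -> (forall i, i \in s -> (i < n)%N) -> (forall i, (i < n)%N -> 1 <= a i) ->
  \prod_(i <- s) a i <= \prod_(i < n) a i.
Proof.
move=> us sn a1; rewrite -(big_mkord xpredT) [leRHS](bigID (mem s)) /=.
have -> : \prod_(i <- s) a i = \prod_(0 <= i < n | i \in s) a i.
  rewrite -[RHS]big_filter; apply: perm_big; apply: uniq_perm => //.
    by rewrite filter_uniq ?iota_uniq.
  move=> i; rewrite mem_filter mem_index_iota /=.
  by case: (boolP (i \in s)) => // /sn ->.
rewrite ler_peMr //.
  rewrite big_nat_cond; apply: prodr_ge0 => i /andP[/andP[_ i1] _].
  by rewrite (le_trans ler01) ?a1.
rewrite big_nat_cond; apply: (big_ind (fun x => 1 <= x)) => // [x y|i].
  exact: mulr_ege1.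
by case/andP=> /andP[_ i1] _; exact: a1.
Qed.

Lemma qform_ge (V : vectType F) d (f : 'End(V)) a v :
  inner_product d -> self_adjoint d f ->
  (forall i, (i < \dim {:V})%N -> a <= (Lambda f)`_i) ->
  a * sqnorm d v <= qform d f v.
Proof.
move=> ipd fsa fa; have [_ [e [oe fe]]] := spectral_theorem ipd fsa.
rewrite (sqnorm_sum ipd oe) (qform_sum ipd oe fe fsa) mulr_sumr.
by apply: ler_sum => j _; rewrite ler_wpM2r ?coord_sq_ge0 ?fa.
Qed.

Lemma qform_gt0 (V : vectType F) d (f : 'End(V)) v :
  inner_product d -> self_adjoint d f ->
  (forall i, (i < \dim {:V})%N -> 0 < (Lambda f)`_i) ->
  v != 0 -> 0 < qform d f v.
Proof.
move=> ipd fsa f0 v0; have [sf _] := spectral_theorem ipd fsa.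
have n0 : (0 < \dim {:V})%N.
  rewrite lt0n dimv_eq0; apply: contraNneq v0 => V0.
  by rewrite -memv0 -V0 memvf.
have last_lt : ((\dim {:V}).-1 < \dim {:V})%N by rewrite prednK.
apply: (@lt_le_trans _ _ ((Lambda f)`_(\dim {:V}).-1 * sqnorm d v)).
  by rewrite mulr_gt0 ?f0 ?sqnorm_gt0.
apply: qform_ge => // i i1; apply: Lambda_nth_le; last by rewrite sf.
by rewrite -ltnS prednK.
Qed.

(** * Eigenvalues compared through a map [pi] with Gram operator [N] *)

Section Comparison.
Variables (U W : vectType F) (d : U -> U -> F) (d' : W -> W -> F).
Variables (f N : 'End(U)) (g : 'End(W)) (pi : 'Hom(U, W)).
Notation p := (\dim {:U}).
Hypotheses (ipd : inner_product d) (ipd' : inner_product d').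
Hypotheses (fsa : self_adjoint d f) (Nsa : self_adjoint d N) (gsa : self_adjoint d' g).
Hypothesis f_gt0 : forall i, (i < p)%N -> 0 < (Lambda f)`_i.
Hypothesis N_gt0 : forall i, (i < p)%N -> 0 < (Lambda N)`_i.
Hypothesis pi_norm : forall u, sqnorm d' (pi u) = qform d N u.
Hypothesis pi_form : forall u, qform d f (N u) <= qform d' g (pi u).

(* [C] is the compression of [f] by the square root of [min(N, c) / c], which
   commutes with [N]. *)
Lemma truncated_congruence c : 0 < c ->
  exists C : 'End(U),
    (forall i, (i < p)%N ->
       [/\ 0 < (Lambda C)`_i, (Lambda C)`_i <= (Lambda f)`_i
         & c * (Lambda C)`_i <= (Lambda g)`_i]) /\
    \prod_(i < p) (Lambda C)`_i =
      \prod_(i < p) (Num.min (Lambda N)`_i c / c) * \prod_(i < p) (Lambda f)`_i.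
Proof.
move=> c0; have [sN [e [oe Ne]]] := spectral_theorem ipd Nsa.
pose m i := Num.min (Lambda N)`_i c / c.
pose r i := Num.sqrt (m i).
have m0 i : (i < p)%N -> 0 < m i by move=> i1; rewrite divr_gt0 // lt_min N_gt0.
have rr i : (i < p)%N -> r i * r i = m i.
  by move=> i1; rewrite -expr2 sqr_sqrtr // ltW // m0.
have r0 i : (i < p)%N -> 0 < r i by move=> i1; rewrite sqrtr_gt0 m0.
have [s [ssa se]] := diagonal_operator_exists ipd r oe.
(* [h] is [s] times the inverse of [N], so that [N (h v) = s v]: at [h v], [pi_form] bounds
   [qform d f (s v)], the form of the future [C] at [v], by the form of [g] at [pi (h v)]. *)
have [h [hsa he]] := diagonal_operator_exists ipd (fun i => r i / (Lambda N)`_i) oe.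
have diagE (q : 'End(U)) (x : nat -> R) v :
    (forall i, (i < p)%N -> q (e i) = ofR R k (x i) *: e i) ->
    q v = \sum_(i < p) (ofR R k (x i) * d v (e i)) *: e i.
  move=> qe; rewrite {1}(orthonormal_expand ipd v oe) // linear_sum.
  by apply: eq_bigr => i _; rewrite linearZ /= qe // scalerA mulrC.
have Nh v : N (h v) = s v.
  rewrite -comp_lfunE (diagE _ r) ?(diagE s r) // => i i1.
  rewrite comp_lfunE he // linearZ /= Ne // scalerA -rmorphM.
  by rewrite divfK // gt_eqF // N_gt0.
have diag0 (q : 'End(U)) (x : nat -> R) v :
    (forall i, (i < p)%N -> q (e i) = ofR R k (x i) *: e i) ->
    (forall i, (i < p)%N -> 0 < x i) -> v != 0 -> q v != 0.
  move=> qe x0; apply: contraNneq => qv0.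
  rewrite (orthonormal_expand ipd v oe) // big1 // => i _.
  have := diagE q x v qe; rewrite qv0 => /(congr1 (d ^~ (e i))).
  rewrite (ip0l ipd) (orthonormal_coord ipd (fun i => ofR R k (x i) * d v (e i)) oe) //.
  move/esym/eqP; rewrite mulf_eq0 => /orP[|/eqP ->]; last by rewrite scale0r.
  by rewrite -(rmorph0 (ofR R k)) (inj_eq (@ofR_inj R k)) gt_eqF // x0.
have dvE (q : 'End(U)) (x : nat -> R) v i :
    (forall i, (i < p)%N -> q (e i) = ofR R k (x i) *: e i) -> (i < p)%N ->
    d (q v) (e i) = ofR R k (x i) * d v (e i).
  move=> qe i1; rewrite (diagE q x) //.
  exact: (orthonormal_coord ipd (fun i => ofR R k (x i) * d v (e i)) oe).
have sn v : sqnorm d (s v) <= sqnorm d v.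
  rewrite !(sqnorm_sum ipd oe); apply: ler_sum => i _.
  rewrite /coord_sq (dvE s r) // rmorphM conjs_ofR mulrACA -rmorphM toR_ofRM rr //.
  by rewrite ler_piMl ?toR_mulJ_ge0 // ler_pdivrMr // mul1r ge_min lexx orbT.
(* On the coordinate along [e i] the left side carries the factor
   [c * m i / N_i = min(N_i, c) / N_i], with [N_i] the eigenvalue of [N]; it is at most [1]. *)
have pin v : c * sqnorm d' (pi (h v)) <= sqnorm d v.
  rewrite pi_norm /qform Nh (orthonormal_parseval ipd _ _ oe) // raddf_sum /=.
  rewrite mulr_sumr (sqnorm_sum ipd oe); apply: ler_sum => i _.
  rewrite (dvE s r) // (dvE h (fun i => r i / (Lambda N)`_i)) //.
  rewrite rmorphM conjs_ofR mulrACA -rmorphM toR_ofRM mulrA.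
  rewrite ler_piMl ?toR_mulJ_ge0 // (mulrA (r i)) rr // mulrA mulrCA divff ?gt_eqF //.
  by rewrite mulr1 ler_pdivrMr ?N_gt0 // mul1r ge_min lexx.
pose C := (s \o (f \o s))%VF.
have CE v : C v = s (f (s v)) by rewrite !comp_lfunE.
have Csa : self_adjoint d C by move=> u v; rewrite !CE ssa fsa ssa.
have Cq v : qform d C v = qform d f (s v) by rewrite /qform CE ssa.
have s0 v : v != 0 -> s v != 0 by exact: diag0 se r0.
have C0 i : (i < p)%N -> 0 < (Lambda C)`_i.
  move=> i1; have [_ [b [ob Cb]]] := spectral_theorem ipd Csa.
  have b1 : d (b i) (b i) = 1 by rewrite ob // eqxx.
  have b0 : b i != 0.
    by apply: contra_eq_neq b1 => ->; rewrite (ip0l ipd) eq_sym oner_neq0.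
  have := qform_gt0 ipd fsa f_gt0 (s0 _ b0).
  by rewrite -Cq (qform_eigen ipd (Cb i i1)) pmulr_lgt0 ?(sqnorm_gt0 ipd).
exists C; split=> [i i1|].
  split; first exact: C0.
  - apply: (le_Lambda (phi := s) ipd ipd Csa fsa i1 s0) => v; rewrite Cq.
    by apply: le_trans; rewrite ler_pM2l ?C0 // sn.
  - apply: (le_Lambda (phi := (pi \o h)%VF) ipd ipd' Csa gsa i1) => v.
      move=> v0; rewrite comp_lfunE; apply/eqP => pihv.
      have hv0 : h v != 0.
        by apply: diag0 he _ v0 => j j1; rewrite divr_gt0 ?r0 ?N_gt0.
      have := qform_gt0 ipd Nsa N_gt0 hv0.
      by rewrite -pi_norm pihv /sqnorm (ip0l ipd') raddf0 ltxx.
    rewrite comp_lfunE Cq -Nh => /le_trans/(_ (pi_form _)); apply: le_trans.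
    by rewrite mulrAC mulrC ler_pM2l ?C0 // pin.
(* Determinants are taken in the eigenbasis of [N]; [s] occurs twice in [C], and
   [r i * r i = m i]. *)
apply: (@ofR_inj R k); rewrite (prod_Lambda ipd Csa oe) !(op_mx_comp ipd) //.
rewrite !det_mulmx (det_op_mx_diag ipd oe se) -(prod_Lambda ipd fsa oe) -!rmorphM.
congr (ofR R k _); rewrite mulrAC -big_split; congr (_ * _).
by apply: eq_bigr => i _; rewrite /= rr.
Qed.

(** The truncation level [1] is an arbitrary positive choice: at any level [C] is positive, and its
    eigenvalues times the level bound those of [g] from below. *)
Lemma compression_Lambda_gt0 i : (i < p)%N -> 0 < (Lambda g)`_i.
Proof.
move=> i1; have [C [/(_ i i1)[C0 _ Cg] _]] := truncated_congruence ltr01.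
by apply: lt_le_trans Cg; rewrite mul1r.
Qed.

(* The multiplicative Lidskii inequality; [c] is the [j]-th smallest eigenvalue
   of [N], so the truncation leaves exactly the [j] smallest ones below [1]. *)
Lemma prod_Lambda_ratio_le s : uniq s -> (forall i, i \in s -> (i < p)%N) ->
  \prod_(i <- s) ((Lambda f)`_i / (Lambda g)`_i) <=
  \prod_(i < size s) ((Lambda N)`_(p - i.+1))^-1.
Proof.
move=> us sp; have [sN _] := spectral_theorem ipd Nsa.
have s_size : (size s <= p)%N.
  rewrite -(size_iota 0 p); apply: uniq_leq_size => // i /sp.
  by rewrite mem_iota.
(* For empty [s] the index [p - size s] would fall outside the list, and [c] would be the default
   [0]. *)
have [/eqP|j0] := posnP (size s).
  by rewrite size_eq0 => /eqP ->; rewrite big_nil big_ord0.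
pose c := (Lambda N)`_(p - size s).
have c0 : 0 < c by rewrite N_gt0 // ltn_subrL j0 (leq_trans j0).
have [C [Ci Cprod]] := truncated_congruence c0.
pose a i := (Lambda f)`_i / (Lambda C)`_i.
have a1 i : (i < p)%N -> 1 <= a i.
  by move=> i1; have [C0 Cf _] := Ci i i1; rewrite /a (ler_pdivlMr _ _ C0) mul1r; exact: Cf.
(* From [c * (Lambda C)_i <= (Lambda g)_i], applied at the selected indices only. *)
apply: (@le_trans _ _ (\prod_(i <- s) (c^-1 * a i))).
  rewrite big_seq [leRHS]big_seq; apply: ler_prod => i /sp i1.
  have [C0 _ Cg] := Ci i i1; have g0 := compression_Lambda_gt0 i1.
  rewrite divr_ge0 ?(ltW (f_gt0 i1)) ?(ltW g0) //= mulrCA ler_pM2l ?f_gt0 //.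
  by rewrite -invfM lef_pV2 // posrE mulr_gt0.
have -> : \prod_(i < size s) ((Lambda N)`_(p - i.+1))^-1 =
    \prod_(i <- s) c^-1 * \prod_(i < p) a i.
  rewrite (big_nth 0%N) big_mkord.
  have -> : \prod_(i < p) a i = \prod_(i < p) (c / Num.min (Lambda N)`_i c).
    have cancelP (P M : R) : P != 0 -> P / (M * P) = M^-1.
      by move=> P0; rewrite invfM mulrCA divff ?mulr1.
    rewrite /a prodf_div. rewrite [X in _ / X = _]Cprod. rewrite cancelP.
      by rewrite -prodfV; apply: eq_bigr => i _; rewrite invf_div.
    by apply/prodf_neq0 => i _; rewrite gt_eqF // f_gt0.
  (* Counting from the smallest eigenvalue, each of the first [size s] factors [c / min(N_i, c)] is
     [c / N_i] and absorbs one [c^-1]; all later factors are [1]. *)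
  rewrite [X in _ = _ * X](reindex_inj rev_ord_inj) /=.
  rewrite (big_ord_widen p (fun i => ((Lambda N)`_(p - i.+1))^-1)) //.
  rewrite (big_ord_widen p (fun=> c^-1)) //.
  rewrite [LHS]big_mkcond [X in _ = X * _]big_mkcond -big_split /=.
  apply: eq_bigr => i _; have ip : (p - i.+1 < p)%N.
    by rewrite ltn_subrL (leq_trans _ (ltn_ord i)).
  case: ltnP => [ij|ji].
    rewrite min_l; first by rewrite mulrA mulVf ?mul1r // gt_eqF.
    by apply: Lambda_nth_le; rewrite ?sN // leq_sub2l.
  rewrite min_r; first by rewrite divff ?mulr1 // gt_eqF.
  apply: Lambda_nth_le; first by rewrite leq_sub2l // ltnW // ltnS.
  by rewrite sN ltn_subrL j0 (leq_trans j0).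
rewrite big_split /= ler_pM2l; first exact: ler_prod_uniq_sub.
by apply: prodr_gt0 => i _; rewrite invr_gt0.
Qed.

End Comparison.
End Lidskii.

(** * Weak majorization *)

Section WeakMajorization.
Variable R : realType.
Implicit Types (x y : seq R) (w z : nat -> R).

(** The [j] largest entries of [x] stand at [j] distinct indices, the head of a sorting permutation.
    Weak majorization thus takes the form that the Lidskii inequality provides. *)
Lemma weakly_majorized_subsums x y : size x = size y -> sorted >=%R y ->
  (forall s, uniq s -> (forall i, i \in s -> (i < size x)%N) ->
     \sum_(i <- s) x`_i <= \sum_(i < size s) y`_i) ->
  weakly_majorized x y.
Proof.
move=> xy sy h; split=> // j /andP[_ jx]; rewrite (sorted_sort (@ge_transitive R) sy).
have : perm_eq (sort >=%R x) x by rewrite perm_sort.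
case/(perm_iotaP 0) => t t_iota ->.
have t_size : size t = size x by rewrite (perm_size t_iota) size_iota.
have tj : size (take j t) = j by rewrite size_takel ?t_size.
have := h (take j t); rewrite tj (big_nth 0%N) big_mkord tj => {}h.
apply: le_trans (h _ _).
- rewrite le_eqVlt; apply/orP; left; apply/eqP/eq_bigr => i _.
  by rewrite (nth_map 0%N) ?nth_take // t_size (leq_trans (ltn_ord i)).
- by rewrite take_uniq // (perm_uniq t_iota) iota_uniq.
- by move=> i /mem_take; rewrite (perm_mem t_iota) mem_iota.
Qed.

(* Abel summation. *)
Lemma antitone_weighted_sum_ge0 n w z :
  (forall i, (i < n)%N -> 0 <= w i) ->
  (forall i j, (i <= j)%N -> (j < n)%N -> w j <= w i) ->
  (forall j, (1 <= j <= n)%N -> 0 <= \sum_(i < j) z i) ->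
  0 <= \sum_(i < n) w i * z i.
Proof.
case: n => [|n] w0 w_anti z0; first by rewrite big_ord0.
(* Strengthened for the induction: all weights are lowered to the last one, which is the
   smallest. *)
suff : w n * \sum_(i < n.+1) z i <= \sum_(i < n.+1) w i * z i.
  by apply: le_trans; rewrite mulr_ge0 ?w0 ?z0 ?leqnn.
elim: n w0 w_anti z0 => [|n IH] w0 w_anti z0.
  by rewrite !big_ord_recr !big_ord0 /= !add0r.
rewrite big_ord_recr [leRHS]big_ord_recr /= mulrDr lerD2r.
apply: le_trans (IH _ _ _).
- by rewrite ler_wpM2r ?w_anti // z0 //= ltnW.
- by move=> i i1; apply: w0; exact: ltnW.
- by move=> i j ij j1; apply: w_anti => //; exact: ltnW.
- by move=> j /andP[j0 j1]; rewrite z0 // j0 ltnW.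
Qed.

(** The tangent bound [e^b - e^a >= e^a (b - a)] leaves a sum of differences of sorted entries with
    weights [e^a]. These weights are nonnegative and nonincreasing, and the partial sums of the
    differences are nonnegative by hypothesis. *)
Lemma weakly_majorized_expR x y : weakly_majorized x y ->
  weakly_majorized [seq expR t - 1 | t <- x] [seq expR t - 1 | t <- y].
Proof.
case=> xy h; split; first by rewrite !size_map.
move=> j; rewrite size_map => /andP[_ jx].
have sortE (s : seq R) :
    sort >=%R [seq expR t - 1 | t <- s] = [seq expR t - 1 | t <- sort >=%R s].
  apply: (sorted_eq (@ge_transitive R)); first by move=> a b /le_anti.
  - by apply: sort_sorted => a b; exact: le_total.
  - rewrite sorted_map (@eq_sorted _ _ >=%R) => [|a b /=]; last by rewrite lerD2r ler_expR.
    by apply: sort_sorted => a b; exact: le_total.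
  - by rewrite perm_sort perm_map // perm_sym perm_sort.
have jx' : (j <= size (sort >=%R x))%N by rewrite size_sort.
have jy' : (j <= size (sort >=%R y))%N by rewrite size_sort -xy.
rewrite !sortE -subr_ge0 -sumrB.
pose z i := (sort >=%R y)`_i - (sort >=%R x)`_i.
apply: (@le_trans _ _ (\sum_(i < j) expR (sort >=%R x)`_i * z i)).
  apply: (@antitone_weighted_sum_ge0 j (fun i => expR (sort >=%R x)`_i) z)
    => [i _|a b ab bj|i /andP[i0 ij]].
  - exact: expR_ge0.
  - rewrite ler_expR; have s_sorted : sorted >=%R (sort >=%R x).
      by apply: sort_sorted => u v; exact: le_total.
    apply: (sorted_leq_nth (@ge_transitive R) _ 0 s_sorted) => //.
    + by move=> u; exact: lexx.
    + by rewrite inE (leq_ltn_trans ab) // (leq_trans bj).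
    + by rewrite inE (leq_trans bj).
  - by rewrite sumrB subr_ge0 h // i0 (leq_trans ij).
apply: ler_sum => i _; rewrite !(nth_map 0) ?(leq_trans (ltn_ord i)) //.
rewrite opprB addrA subrK -{1}[(sort >=%R y)`_i](subrK (sort >=%R x)`_i) -/(z i).
have := ler_wpM2l (expR_ge0 (sort >=%R x)`_i) (expR_ge1Dx (z i)).
by rewrite mulrDr mulr1 -expRD [_ + z i]addrC lerBrDl.
Qed.

Lemma sum_ln_le (I J : Type) (s : seq I) (t : seq J) (P : pred I) (Q : pred J)
    (a : I -> R) (b : J -> R) :
  (forall i, P i -> 0 < a i) -> (forall j, Q j -> 0 < b j) ->
  \prod_(i <- s | P i) a i <= \prod_(j <- t | Q j) b j ->
  \sum_(i <- s | P i) ln (a i) <= \sum_(j <- t | Q j) ln (b j).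
Proof.
move=> a0 b0 ab; rewrite -ler_expR !expR_sum.
rewrite (eq_bigr a) => [|i Pi]; last by rewrite lnK // posrE a0.
by rewrite [leRHS](eq_bigr b) // => i Qi; rewrite lnK // posrE b0.
Qed.

Lemma acos_sqrt_tan2 (mu : R) : 0 < mu <= 1 ->
  1 + tan (acos (Num.sqrt mu)) ^+ 2 = mu^-1.
Proof.
case/andP=> mu0 mu1; have cosE : cos (acos (Num.sqrt mu)) = Num.sqrt mu.
  rewrite acosK // in_itv /= (le_trans _ (sqrtr_ge0 mu)) //=.
  by rewrite -sqrtr1 ler_wsqrtr.
rewrite -cos2_tan2 cosE ?sqr_sqrtr ?ltW //.
by rewrite gt_eqF // sqrtr_gt0.
Qed.

(** [Num.sqrt] sends nonpositive numbers to [0], where [acos] equals [pi / 2]. This turns the angle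
    hypothesis into positivity of the squared cosines. *)
Lemma acos_sqrt_lt_pihalf (mu : R) : acos (Num.sqrt mu) < pi / 2 -> 0 < mu.
Proof. by have [//|mu0] := ltP 0 mu; rewrite ler0_sqrtr // acos0 ltxx. Qed.

(** The scalar half of the argument, free of operators. [S] lists the squared cosines decreasingly,
    so reversing it lists the angles decreasingly, and index [p - i.+1] reads the squared cosines
    from the smallest up. *)
Lemma log_quotient_majorization p (LX LY S : seq R) (m : R) :
  size LX = p -> size LY = p -> size S = p -> sorted >=%R S ->
  (forall i, (i < p)%N -> 0 < S`_i <= 1) ->
  (forall i, (i < p)%N -> m < LY`_i) ->
  (forall i, (i < p)%N -> LY`_i <= LX`_i) ->
  (forall s, uniq s -> (forall i, i \in s -> (i < p)%N) ->
     \prod_(i <- s) ((LX`_i - m) / (LY`_i - m)) <=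
     \prod_(i < size s) (S`_(p - i.+1))^-1) ->
  let Theta := [seq acos (Num.sqrt mu) | mu <- rev S] in
  let logquot := [seq ln ((l.1 - m) / (l.2 - m)) | l <- zip LX LY] in
  let quot := [seq (l.1 - l.2) / (l.2 - m) | l <- zip LX LY] in
  ((forall x : R, x \in logquot -> 0 <= x)
     /\ weakly_majorized logquot [seq ln (1 + tan t ^+ 2) | t <- Theta]) /\
  ((forall x : R, x \in quot -> 0 <= x)
     /\ weakly_majorized quot [seq tan t ^+ 2 | t <- Theta]).
Proof.
move=> sX sY sS S_sorted S01 LY_gt LYX ratio Theta logquot quot.
have S0 i : (i < p)%N -> 0 < S`_i by move=> /S01/andP[].
have rev_lt i : (i < p)%N -> (p - i.+1 < p)%N.
  by move=> ip; rewrite ltn_subrL (leq_trans _ ip).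
have S_anti i j : (i <= j)%N -> (j < p)%N -> S`_j <= S`_i.
  move=> ij jp; apply: (sorted_leq_nth (@ge_transitive R) _ 0 S_sorted) => //.
  - by move=> x; exact: lexx.
  - by rewrite inE sS; exact: leq_ltn_trans jp.
  - by rewrite inE sS.
pose a i := (LX`_i - m) / (LY`_i - m).
have a1 i : (i < p)%N -> 1 <= a i.
  by move=> ip; rewrite ler_pdivlMr ?subr_gt0 ?LY_gt // mul1r lerD2r LYX.
have zipE (h : R * R -> R) :
    [seq h l | l <- zip LX LY] = mkseq (fun i => h (LX`_i, LY`_i)) p.
  apply: (@eq_from_nth _ 0) => [|i]; rewrite size_map size_zip sX sY minnn ?size_mkseq //.
  move=> ip; rewrite nth_mkseq // (nth_map (0, 0)) ?size_zip ?sX ?sY ?minnn //.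
  by rewrite nth_zip ?sX ?sY.
have logE : logquot = mkseq (fun i => ln (a i)) p by exact: zipE.
have logTE : [seq ln (1 + tan t ^+ 2) | t <- Theta]
    = mkseq (fun i => ln (S`_(p - i.+1))^-1) p.
  apply: (@eq_from_nth _ 0) => [|i]; rewrite !size_map size_rev sS ?size_iota //.
  move=> ip; rewrite nth_mkseq // (nth_map 0) ?size_map ?size_rev ?sS //.
  rewrite (nth_map 0) ?size_rev ?sS // nth_rev ?sS //.
  have qp := rev_lt i ip.
  by rewrite acos_sqrt_tan2 // S01.
(* Subtracting [1] from [(LX - m) / (LY - m)] gives [(LX - LY) / (LY - m)]. *)
have quotE : quot = [seq expR t - 1 | t <- logquot].
  rewrite logE /quot zipE /mkseq -map_comp; apply/eq_in_map => i /=.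
  rewrite mem_iota add0n => ip; have LYm : 0 < LY`_i - m by rewrite subr_gt0 LY_gt.
  rewrite lnK; last by rewrite posrE (lt_le_trans ltr01) ?a1.
  by rewrite -[X in _ = _ - X](divff (lt0r_neq0 LYm)) -mulrBl opprB addrA subrK.
have tan2E : [seq tan t ^+ 2 | t <- Theta]
    = [seq expR t - 1 | t <- [seq ln (1 + tan t ^+ 2) | t <- Theta]].
  rewrite -map_comp; apply/eq_in_map => t _ /=.
  by rewrite lnK ?posrE ?ltr_pwDl ?sqr_ge0 // addrC addKr.
have log_maj : weakly_majorized logquot [seq ln (1 + tan t ^+ 2) | t <- Theta].
  rewrite logE logTE; apply: weakly_majorized_subsums; rewrite ?size_mkseq //.
    apply: (homo_sorted_in (P := gtn p) (e := ltn)); last exact: iota_ltn_sorted.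
      move=> i j ip jp ij; rewrite /= ler_ln ?posrE ?invr_gt0 ?lef_pV2 ?posrE ?S0 ?rev_lt //.
      by apply: S_anti; rewrite ?rev_lt // leq_sub2l // ltnS ltnW.
    by apply/allP => i; rewrite mem_iota.
  move=> s us sp; have sizes : (size s <= p)%N.
    rewrite -(size_iota 0 p); apply: uniq_leq_size => // i /sp.
    by rewrite mem_iota.
  have -> : \sum_(i <- s) (mkseq (fun i => ln (a i)) p)`_i =
      \sum_(i <- s | i \in s) ln (a i).
    by rewrite big_seq; apply: eq_bigr => i /sp ip; rewrite nth_mkseq.
  have -> : \sum_(i < size s) (mkseq (fun i => ln (S`_(p - i.+1))^-1) p)`_i =
      \sum_(i < size s) ln (S`_(p - i.+1))^-1.
    by apply: eq_bigr => i _; rewrite nth_mkseq // (leq_trans (ltn_ord i)).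
  apply: sum_ln_le => [i /sp ip|i _|].
  - by rewrite (lt_le_trans ltr01) ?a1.
  - by rewrite invr_gt0 S0 // rev_lt // (leq_trans (ltn_ord i)).
  - by rewrite -big_seq; exact: ratio.
split; split=> //.
- move=> x; rewrite logE => /mapP[j]; rewrite mem_iota => jp ->.
  by rewrite ln_ge0 ?a1.
- rewrite /quot zipE => x /mapP[j]; rewrite mem_iota => jp ->.
  by rewrite divr_ge0 ?subr_ge0 ?LYX // ltW ?LY_gt.
- by rewrite quotE tan2E; exact: weakly_majorized_expR.
Qed.

End WeakMajorization.

(** * Orthogonal projectors and compressions *)

Section Compressions.
Variables (R : realType) (k : scalar_kind) (V : vectType (scalars R k)).
Variable dot : {dot V for conjs R k}.
Notation F := (scalars R k).
Implicit Types (X Y Z : {vspace V}) (A : 'End(V)).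

Lemma inner_product_dot : inner_product dot.
Proof.
split=> [a u v w|u v|u].
- by rewrite linearPl.
- by rewrite hermC expr0 mul1r.
- exact: neq0_dnorm_gt0.
Qed.
Let ipd := inner_product_dot.
Notation dsub := (@sub_ip _ _ V dot _).
Let ipsub Z : inner_product (@sub_ip _ _ V dot Z) := inner_product_sub Z ipd.

Lemma in_orthov Z u : u \in orthov dot Z <-> forall z, z \in Z -> dot u z = 0.
Proof. by split=> [/mem_orthovP|h]; last apply/mem_orthovP. Qed.

(** An orthonormal basis of [Z] comes from the spectral theorem applied to the identity of [Z]; [z]
    is the corresponding Fourier sum of [v]. *)
Lemma orthogonal_decomposition Z v :
  exists2 z, z \in Z & v - z \in orthov dot Z.
Proof.
have id_sa : self_adjoint (@sub_ip _ _ V dot Z) \1%VF by move=> u w; rewrite !id_lfunE.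
have [_ [e [oe _]]] := spectral_theorem (ipsub Z) id_sa.
pose n := \dim {:subvs_of Z}.
exists (vsval (\sum_(i < n) dot v (vsval (e i)) *: e i)); first exact: subvsP.
apply/in_orthov => z zZ; rewrite -[z](vsprojK zZ); set y := vsproj Z z.
rewrite (ipBl ipd) [dot (vsval _) _](ip_suml (ipsub Z) _ _ _ y).
rewrite [X in dot v (vsval X)](orthonormal_expand (ipsub Z) y oe) // linear_sum.
rewrite (ip_sumr ipd) -sumrB big1 // => i _.
rewrite (ipZl (ipsub Z)).
rewrite /= (ipZr ipd) mulrC.
by rewrite -(ip_conj (ipsub Z)) subrr.
Qed.

Lemma oproj_in Z v : oproj dot Z v \in Z.
Proof. exact: memv_pi. Qed.

(** [daddv_pi] splits [v] as intended because [Z] meets its orthogonal complement trivially and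
    their sum contains [v]; the component in the complement is then invisible to [z]. *)
Lemma oproj_orth Z v z : z \in Z -> dot (oproj dot Z v) z = dot v z.
Proof.
move=> zZ.
have cap0 : (Z :&: orthov dot Z = 0)%VS.
  apply/eqP; rewrite -subv0; apply/subvP => u; rewrite memv_cap memv0.
  case/andP=> uZ /in_orthov/(_ u uZ) uu.
  by apply: contra_eqT uu => /(ip_gt0 ipd) u0; rewrite gt_eqF.
have vin : v \in (Z + orthov dot Z)%VS.
  have [y yZ vy] := orthogonal_decomposition Z v.
  by rewrite -(subrK y v) addrC memv_add.
rewrite -{2}(daddv_pi_add cap0 vin) (ipDl ipd).
by rewrite ((in_orthov Z _).1 (memv_pi _ _ _) z zZ) addr0.
Qed.

Lemma oproj_orth_r Z v z : z \in Z -> dot z (oproj dot Z v) = dot z v.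
Proof. by move=> zZ; rewrite (ip_conj ipd) oproj_orth // -(ip_conj ipd). Qed.

Lemma oproj_id Z v : v \in Z -> oproj dot Z v = v.
Proof.
move=> vZ; apply/eqP; rewrite -subr_eq0; apply/eqP.
have := oproj_orth v (rpredB (oproj_in Z v) vZ).
move/eqP; rewrite -subr_eq0 -(ipBl ipd) => uu.
by apply/eqP; apply: contraTT uu => /(ip_gt0 ipd) u0; rewrite gt_eqF.
Qed.

Lemma compressE Z A u : vsval (compress dot Z A u) = oproj dot Z (A (vsval u)).
Proof. by rewrite restr_opE comp_lfunE // oproj_in. Qed.

Lemma ip_compress Z A u v :
  dsub (compress dot Z A u) v = dot (A (vsval u)) (vsval v).
Proof. by rewrite /sub_ip compressE oproj_orth // subvsP. Qed.

Lemma compress_sa Z A : hermitian_op dot A ->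
  self_adjoint (@sub_ip _ _ V dot Z) (compress dot Z A).
Proof.
move=> Asa u v; rewrite ip_compress Asa /sub_ip compressE oproj_orth_r ?subvsP //.
Qed.

Lemma compress_invariant X A : (A @: X <= X)%VS -> compress dot X A = restr_op X A.
Proof.
move=> AX; apply/lfunP => u; apply: val_inj; rewrite /= compressE.
have Au : A (vsval u) \in X by rewrite (subvP AX) // memv_img // subvsP.
by rewrite restr_opE // oproj_id.
Qed.

Lemma Lambda_shift (U : vectType F) (f : 'End(U)) m :
  Lambda (f - ofR R k m *: \1)%VF = [seq l - m | l <- Lambda f].
Proof.
apply: is_Lambda_uniq (LambdaP _) _; have [sf cf] := LambdaP f; split=> [|a].
  rewrite sorted_map (@eq_sorted _ _ >=%R) // => x y /=.
  by rewrite lerD2r.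
rewrite count_map (eq_count (a2 := pred1 (a + m))) => [|x] /=; last by rewrite subr_eq.
rewrite cf /passmx.leigenspace rmorphD /= scalerDl; congr (\dim (lker _)).
by rewrite opprD addrA addrAC.
Qed.

Lemma lambda_min_le Z A z : hermitian_op dot A -> z \in Z ->
  lambda_min dot Z A * sqnorm dot z <= qform dot A z.
Proof.
move=> Asa zZ; have csa := @compress_sa Z A Asa.
have [sc _] := spectral_theorem (ipsub Z) csa.
have := @qform_ge _ _ _ _ _ (lambda_min dot Z A) (vsproj Z z) (ipsub Z) csa.
rewrite /qform ip_compress /sqnorm /sub_ip vsprojK //; apply => i i1.
rewrite /lambda_min -nth_last; apply: Lambda_nth_le; rewrite sc.
  by rewrite -ltnS prednK // (leq_trans _ i1).
by rewrite prednK // (leq_trans _ i1).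
Qed.

End Compressions.

(** * Ritz values on [Y] against those on [X] *)

Section RayleighRitz.
Variables (R : realType) (k : scalar_kind) (V : vectType (scalars R k)).
Variable dot : {dot V for conjs R k}.
Notation F := (scalars R k).
Variables (A : 'End(V)) (X Y : {vspace V}).
Hypothesis Asa : hermitian_op dot A.
Let ipd := inner_product_dot dot.
Notation dsub := (@sub_ip _ _ V dot _).
Let ipsub Z : inner_product (@sub_ip _ _ V dot Z) := inner_product_sub Z ipd.

Definition angle_op := restr_op X (oproj dot X \o oproj dot Y)%VF.

Lemma size_Lambda_compress Z : size (Lambda (compress dot Z A)) = \dim Z.
Proof. by have [-> _] := spectral_theorem (ipsub Z) (compress_sa Asa); rewrite dim_subvs.
Qed.

(** Half of Cauchy interlacing: the inclusion of [Y] preserves norms and forms. With [X] at the top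
    of the spectrum it gives the nonnegativity of both quotient vectors. *)
Lemma compress_Lambda_le i : (i < \dim Y)%N ->
  (Lambda (compress dot Y A))`_i <= (Lambda A)`_i.
Proof.
move=> iY; pose phi : 'Hom(subvs_of Y, V) := linfun vsval.
have phiE u : phi u = vsval u by rewrite lfunE.
apply: (le_Lambda (phi := phi) (ipsub Y) ipd (compress_sa Asa) Asa) => [|u u0|u].
- by rewrite dim_subvs.
- by rewrite phiE; apply: contraNneq u0 => u0; apply/eqP/val_inj.
- by rewrite /qform ip_compress phiE.
Qed.

(** The Gram operator of [P_Y] restricted to [X]; self-adjointness, the bound by [1] and the norm
    identity for [pi] are all read off from this. *)
Lemma ip_angle_op u v :
  dsub (angle_op u) v = dot (oproj dot Y (vsval u)) (oproj dot Y (vsval v)).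
Proof.
rewrite /sub_ip restr_opE comp_lfunE ?oproj_in // oproj_orth ?subvsP //.
by rewrite oproj_orth_r ?oproj_in.
Qed.

Lemma angle_op_sa : self_adjoint (@sub_ip _ _ V dot X) angle_op.
Proof.
by move=> u v; rewrite ip_angle_op (ip_conj (ipsub X) u) ip_angle_op -(ip_conj ipd).
Qed.

Lemma size_Lambda_angle_op : size (Lambda angle_op) = \dim X.
Proof. by have [-> _] := spectral_theorem (ipsub X) angle_op_sa; rewrite dim_subvs. Qed.

Lemma Lambda_angle_op_le1 i : (i < \dim X)%N -> (Lambda angle_op)`_i <= 1.
Proof.
rewrite -dim_subvs => i1; have [_ [e [oe Ne]]] := spectral_theorem (ipsub X) angle_op_sa.
have e1 : sqnorm (@sub_ip _ _ V dot X) (e i) = 1.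
  by rewrite /sqnorm oe // eqxx -(rmorph1 (ofR R k)) ofRK.
rewrite -[leLHS]mulr1 -{1}e1 -(qform_eigen (ipsub X) (Ne i i1)) -e1 /qform ip_angle_op.
set u := vsval (e i); rewrite /sqnorm /sub_ip -/u -subr_ge0 -raddfB /=.
(* Pythagoras for the projection of [u] onto [Y]. *)
have -> : dot u u - dot (oproj dot Y u) (oproj dot Y u)
        = dot (u - oproj dot Y u) (u - oproj dot Y u).
  have PuP := oproj_in dot Y u.
  have PuE : dot (oproj dot Y u) u = dot u (oproj dot Y u).
    by rewrite -(oproj_orth_r dot u PuP) oproj_orth.
  by rewrite (ipBl ipd) !(ipBr ipd) PuE oproj_orth // subrr subr0.
exact: sqnorm_ge0.
Qed.

Hypothesis AX : (A @: X <= X)%VS.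
Notation m := (lambda_min dot (X + Y)%VS A).
Notation LX := (Lambda (compress dot X A)).
Notation LY := (Lambda (compress dot Y A)).
Hypothesis LX_gt : forall i, (i < \dim X)%N -> m < LX`_i.
Hypothesis angle_gt0 : forall i, (i < \dim X)%N -> 0 < (Lambda angle_op)`_i.
Hypothesis dimXY : \dim X = \dim Y.

(* [A] is block diagonal for [X] and its complement in [X + Y], on which it is
   at least [m]. *)
Lemma shifted_form_le y : y \in Y ->
  qform dot A (oproj dot X y) - m * sqnorm dot (oproj dot X y) <=
  qform dot A y - m * sqnorm dot y.
Proof.
move=> yY; set x := oproj dot X y; have xX : x \in X by exact: oproj_in.
have [z zE] : exists z, z = y - x by exists (y - x).
have yE : y = x + z by rewrite zE addrC subrK.
have orth w : w \in X -> dot z w = 0.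
  by move=> wX; rewrite zE (ipBl ipd) oproj_orth // subrr.
have orth' w : w \in X -> dot w z = 0.
  by move=> wX; rewrite (ip_conj ipd) orth // rmorph0.
have zZ : z \in (X + Y)%VS.
  by rewrite zE rpredB ?(subvP (addvSl X Y) x) ?(subvP (addvSr X Y) y).
have AxX : A x \in X by rewrite (subvP AX) // memv_img.
have nE : sqnorm dot y = sqnorm dot x + sqnorm dot z.
  by rewrite /sqnorm yE (ipDl ipd) !(ipDr ipd) orth // orth' // addr0 add0r raddfD.
(* Both cross terms vanish: [A x] stays in [X], to which [z] is orthogonal, and [A] is Hermitian. *)
have qE : qform dot A y = qform dot A x + qform dot A z.
  rewrite /qform yE [A (_ + _)]linearD (ipDl ipd) !(ipDr ipd).
  rewrite orth' // (Asa z x) orth // addr0 add0r.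
  by rewrite raddfD.
by rewrite nE qE mulrDr opprD addrACA lerDl subr_ge0 lambda_min_le.
Qed.

Let shifted Z := (compress dot Z A - ofR R k m *: \1)%VF.

Let shifted_sa Z : self_adjoint (@sub_ip _ _ V dot Z) (shifted Z).
Proof.
move=> u v; rewrite /shifted !add_lfunE !opp_lfunE !scale_lfunE !id_lfunE.
by rewrite (ipBl (ipsub Z)) (ipBr (ipsub Z)) (compress_sa Asa) (ipZl (ipsub Z))
  (ipZr (ipsub Z)) conjs_ofR.
Qed.

Let shifted_qform Z u : qform (@sub_ip _ _ V dot Z) (shifted Z) u =
  qform dot A (vsval u) - m * sqnorm dot (vsval u).
Proof.
rewrite /qform /shifted add_lfunE opp_lfunE scale_lfunE id_lfunE (ipBl (ipsub Z)).
by rewrite ip_compress (ipZl (ipsub Z)) raddfB /= toR_ofRM.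
Qed.

Let shifted_Lambda Z i : (i < \dim Z)%N ->
  (Lambda (shifted Z))`_i = (Lambda (compress dot Z A))`_i - m.
Proof.
by move=> iZ; rewrite /shifted Lambda_shift (nth_map 0) // size_Lambda_compress.
Qed.

(** Instance of the comparison with [f] and [g] the compressions of [A - m], and [N] the angle
    operator. [LX_gt] and [angle_gt0] make [f] and [N] positive; equal dimensions let the Ritz
    values on [X] and [Y] share their indices. *)
Lemma LY_gt_and_ratio :
  (forall i, (i < \dim X)%N -> m < LY`_i) /\
  (forall s, uniq s -> (forall i, i \in s -> (i < \dim X)%N) ->
     \prod_(i <- s) ((LX`_i - m) / (LY`_i - m)) <=
     \prod_(i < size s) ((Lambda angle_op)`_(\dim X - i.+1))^-1).
Proof.
pose pi : 'Hom(subvs_of X, subvs_of Y) := linfun (vsproj Y \o oproj dot Y \o vsval).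
have piE u : vsval (pi u) = oproj dot Y (vsval u) by rewrite lfunE /= vsprojK ?oproj_in.
have f0 i : (i < \dim {:subvs_of X})%N -> 0 < (Lambda (shifted X))`_i.
  by rewrite dim_subvs => iX; rewrite shifted_Lambda // subr_gt0 LX_gt.
have N0 i : (i < \dim {:subvs_of X})%N -> 0 < (Lambda angle_op)`_i.
  by rewrite dim_subvs => /angle_gt0.
have pi_norm u : sqnorm (@sub_ip _ _ V dot Y) (pi u) =
    qform (@sub_ip _ _ V dot X) angle_op u.
  by rewrite /qform ip_angle_op /sqnorm /sub_ip piE.
(* [angle_op u] is the projection onto [X] of [y = P_Y u], so this is [shifted_form_le] at that
   [y]. *)
have pi_form u : qform (@sub_ip _ _ V dot X) (shifted X) (angle_op u)
    <= qform (@sub_ip _ _ V dot Y) (shifted Y) (pi u).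
  rewrite !shifted_qform piE restr_opE comp_lfunE ?oproj_in //.
  exact: shifted_form_le (oproj_in _ _ _).
have fE i : (i < \dim X)%N -> (Lambda (shifted X))`_i = LX`_i - m.
  exact: shifted_Lambda.
have gE i : (i < \dim X)%N -> (Lambda (shifted Y))`_i = LY`_i - m.
  by rewrite dimXY; exact: shifted_Lambda.
split=> [i iX|s us sX].
  rewrite -subr_gt0 -(gE i iX).
  apply: (compression_Lambda_gt0 (ipsub X) (ipsub Y) (@shifted_sa X) angle_op_sa
    (@shifted_sa Y) f0 N0 pi_norm pi_form).
  by rewrite dim_subvs.
have := prod_Lambda_ratio_le (ipsub X) (ipsub Y) (@shifted_sa X) angle_op_sa
    (@shifted_sa Y) f0 N0 pi_norm pi_form us.
rewrite dim_subvs => /(_ sX); apply: le_trans.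
rewrite big_seq [leRHS]big_seq le_eqVlt; apply/orP; left; apply/eqP/eq_bigr => i /sX iX.
exact: esym (congr2 (fun x y => x / y) (fE i iX) (gE i iX)).
Qed.

End RayleighRitz.

Theorem theorem2p3 (R : realType) (k : scalar_kind)
    (V : vectType (scalars R k)) (dot : {dot V for conjs R k})
    (A : 'End(V)) (X Y : {vspace V}) :
  hermitian_op dot A ->
  \dim X = \dim Y ->
  (A @: X <= X)%VS ->
  corresponds_to_largest A X ->
  let LX := Lambda (compress dot X A) in
  let LY := Lambda (compress dot Y A) in
  let m := lambda_min dot (X + Y)%VS A in
  let Theta := principal_angles dot X Y in
  let logquot := [seq ln ((l.1 - m) / (l.2 - m)) | l <- zip LX LY] in
  let quot := [seq (l.1 - l.2) / (l.2 - m) | l <- zip LX LY] in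
  (forall t, t \in Theta -> t < pi / 2) ->
  (forall l, l \in LX -> m < l) ->
  [/\ forall l, l \in LY -> m < l,
      (forall x, x \in logquot -> 0 <= x)
        /\ weakly_majorized logquot [seq ln (1 + tan t ^+ 2) | t <- Theta]
    & (forall x, x \in quot -> 0 <= x)
        /\ weakly_majorized quot [seq tan t ^+ 2 | t <- Theta]].
Proof.
move=> Asa dimXY AX Xtop LX LY m Theta logquot quot Theta_lt LX_gt.
pose p := \dim X; pose S := Lambda (angle_op dot X Y).
have sS : size S = p by exact: size_Lambda_angle_op.
have sX : size LX = p by exact: size_Lambda_compress.
have sY : size LY = p by rewrite /p dimXY; exact: size_Lambda_compress.
have S0 i : (i < p)%N -> 0 < S`_i.
  move=> ip; apply: acos_sqrt_lt_pihalf; apply: Theta_lt.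
  by apply: (map_f (fun mu => acos (Num.sqrt mu))); rewrite mem_rev mem_nth ?sS.
have S1 i : (i < p)%N -> S`_i <= 1 by exact: Lambda_angle_op_le1.
have LX_nth i : (i < p)%N -> m < LX`_i by move=> ip; apply: LX_gt; rewrite mem_nth ?sX.
(* By the choice of [X], the entry of [LX] at [i] is that of [Lambda A], which dominates by
   interlacing. *)
have LYX i : (i < p)%N -> LY`_i <= LX`_i.
  move=> ip; have := @compress_Lambda_le _ _ _ _ _ Y Asa i.
  by rewrite -dimXY => /(_ ip); rewrite /LX (compress_invariant dot AX) Xtop nth_take.
have [LYn ratio] := LY_gt_and_ratio Asa AX LX_nth S0 dimXY.
have S_sorted : sorted >=%R S by have [] := LambdaP (angle_op dot X Y).
have S01 i : (i < p)%N -> 0 < S`_i <= 1 by move=> ip; rewrite S0 ?S1.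
have [log_maj quot_maj] := log_quotient_majorization sX sY sS S_sorted S01 LYn LYX ratio.
split; [|exact: log_maj|exact: quot_maj].
by move=> l /(nthP 0)[j]; rewrite sY => jp <-; exact: LYn.
Qed.
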